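(* Fix $n\ge2$ and $B\le\mathcal{S}_n$, and let $G_1,G_2,\dots$ be a sequence of groups where each $G_m$ satisfies $\mathcal{A}_m^{[n]}\trianglelefteq G_m\le\mathcal{S}_m\wr_P\mathcal{S}_n$ and $\pi_n(G_m)=B$ (independent of $m$). Then $$\lim_{m\to\infty}\delta(G_m)=1-\frac{1}{|B|}\sum_{\ell=1}^n\genfrac{[}{]}{0pt}{}{B}{\ell}(1-e^{-1})^\ell>e^{-1}.$$
   Context: $\mathcal{S}_n$ and $\mathcal{A}_n$ are the symmetric and alternating groups on $[n]=\{1,\dots,n\}$; permutations act on the right, $x\mapsto xg$. For a finite group $G$ acting on a finite set, $\delta(G)$ is the proportion of elements of $G$ with no fixed points. For $B\le\mathcal{S}_n$, $\genfrac{[}{]}{0pt}{}{B}{\ell}$ is the number of elements of $B$ with exactly $\ell$ cycles in their disjoint cycle decomposition (fixed points counted as cycles). $e$ is Euler's number. The wreath product $\mathcal{S}_m\wr\mathcal{S}_n=\mathcal{S}_m^{[n]}\rtimes\mathcal{S}_n$ has underlying set $\mathcal{S}_m^{[n]}\times\mathcal{S}_n$ ($\mathcal{S}_m^{[n]}$ being the group of functions $[n]\to\mathcal{S}_m$ under pointwise multiplication) and multiplication $(\alpha,b)(\beta,c)=(\alpha\beta^{b^{-1}},bc)$, where $\beta^{b}(y)=\beta(yb^{-1})$. $\mathcal{S}_m\wr_P\mathcal{S}_n$ denotes this group acting on the set $[m]^{[n]}$ of functions $\omega\colon[n]\to[m]$ by $(\omega(\alpha,b))(y)=\omega(yb^{-1})\alpha(yb^{-1})$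 (power action); subgroups act by restriction. $\pi_n\colon\mathcal{S}_m\wr_P\mathcal{S}_n\to\mathcal{S}_n$ is the projection $(\alpha,b)\mapsto b$. $\mathcal{A}_m^{[n]}$ is the group of functions $[n]\to\mathcal{A}_m$, identified with $\{(\alpha,1)\mid\alpha\in\mathcal{A}_m^{[n]}\}$. *)

(* Defs.v *)
From HB Require Import structures.
From mathcomp Require Import all_boot all_order all_algebra.
From mathcomp Require Import all_fingroup alt.

Set Implicit Arguments.
Unset Strict Implicit.
Unset Printing Implicit Defensive.

Import GroupScope.

(* The points [n] = {1, ..., n} are modelled by 'I_n = {0, ..., n-1}.         *)
(* Permutations act on the right, as in MathComp: (s * t) x = t (s x).        *)

Section Wreath.

Variables m n : nat.

Record wreath : predArgType := Wreath {
  wr_base : {ffun 'I_n -> 'S_m};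
  wr_top : 'S_n
}.

Definition pair_of_wreath (g : wreath) := (wr_base g, wr_top g).
Definition wreath_of_pair p := Wreath p.1 p.2.

Lemma pair_of_wreathK : cancel pair_of_wreath wreath_of_pair.
Proof. by case. Qed.

HB.instance Definition _ := Finite.copy wreath (can_type pair_of_wreathK).

(* be ^ b, where (be ^ b)(y) = be (y b^-1), so that the product is            *)
(* (al, b)(be, c) = (al * be ^ (b^-1), b * c).                                *)
Definition wr_twist (be : {ffun 'I_n -> 'S_m}) (b : 'S_n) :
  {ffun 'I_n -> 'S_m} := [ffun y => be (b^-1 y)].

Definition wr_mul (g h : wreath) : wreath :=
  Wreath [ffun y => wr_base g y * wr_twist (wr_base h) (wr_top g)^-1 y]
         (wr_top g * wr_top h).

Definition wr_one : wreath := Wreath [ffun=> 1] 1.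

Definition wr_inv (g : wreath) : wreath :=
  Wreath [ffun y => (wr_twist (wr_base g) (wr_top g) y)^-1] (wr_top g)^-1.

Lemma wr_mulA : associative wr_mul.
Proof.
move=> [a b] [c d] [e f]; rewrite /wr_mul /wr_twist /= mulgA; congr Wreath.
by apply/ffunP => y; rewrite !ffunE !invgK permM mulgA.
Qed.

Lemma wr_mul1 : left_id wr_one wr_mul.
Proof.
move=> [a b]; rewrite /wr_mul /wr_twist /= mul1g; congr Wreath.
by apply/ffunP => y; rewrite !ffunE mul1g !invgK perm1.
Qed.

Lemma wr_mulV : left_inverse wr_one wr_inv wr_mul.
Proof.
move=> [a b]; rewrite /wr_mul /wr_twist /= mulVg; congr Wreath.
by apply/ffunP => y; rewrite !ffunE !invgK mulVg.
Qed.

HB.instance Definition _ :=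
  Finite_isGroup.Build wreath wr_mulA wr_mul1 wr_mulV.

Lemma wr_top_morphM : {in [set: wreath] &, {morph wr_top : g h / g * h}}.
Proof. by []. Qed.

Canonical wr_top_morphism := Morphism wr_top_morphM.

(* (w (al, b))(y) = (w (y b^-1)) (al (y b^-1)), an action on the right.       *)
Definition power_act (w : {ffun 'I_n -> 'I_m}) (g : wreath) :
  {ffun 'I_n -> 'I_m} :=
  [ffun y => wr_base g ((wr_top g)^-1 y) (w ((wr_top g)^-1 y))].

Lemma power_act1 : power_act^~ 1 =1 id.
Proof.
by move=> w; apply/ffunP => y; rewrite !ffunE /= invg1 !perm1.
Qed.

Lemma power_actM w : act_morph power_act w.
Proof.
move=> [a b] [c d]; apply/ffunP => y.
by rewrite !ffunE /= invgK invMg !permM permKV.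
Qed.

Canonical power_action := TotalAction power_act1 power_actM.

(* The functions [n] -> A_m, identified with elements (alpha, 1).             *)
Definition alt_base : {set wreath} :=
  [set g | [forall y, wr_base g y \in 'Alt_('I_m)] & wr_top g == 1].

Lemma alt_base_group_set : group_set alt_base.
Proof.
apply/group_setP; split=> [|[a b] [c d]]; rewrite !inE /=.
  by rewrite eqxx andbT; apply/forallP => y; rewrite ffunE group1.
move=> /andP[/forallP aA /eqP->] /andP[/forallP cA /eqP->].
rewrite mulg1 eqxx andbT; apply/forallP => y.
by rewrite ffunE groupM // ffunE.
Qed.

Canonical alt_base_group := Group alt_base_group_set.

End Wreath.

Local Open Scope ring_scope.

Definition derangement_proportion (R : fieldType) (gT : finGroupType)
    (T : finType) (to : {action gT &-> T}) (G : {group gT}) : R :=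
  #|[set g in G | 'Fix_to[g]%g == set0]|%:R / #|G|%:R.

(* porbits b contains the singleton cycles of the fixed points of b.          *)
Definition cycle_count (n : nat) (B : {group 'S_n}) (l : nat) : nat :=
  #|[set b in B | #|porbits b| == l]|.

(* Main.v *)
Require Import Defs.
From mathcomp Require Import all_boot all_order all_algebra all_fingroup alt.
From mathcomp Require Import classical_sets reals topology normedtype.
From mathcomp Require Import sequences exp.
From mathcomp Require Import ring lra zify.

(* An element (a, b) fixes a point of [m]^[n] iff the product of the values of
   a along each cycle of b has a fixed point in [m].  As (a, b) ranges over a
   coset of A_m^[n], these cycle products range uniformly and independently
   over cosets of A_m in S_m, and by inclusion-exclusion the proportion of
   elements with a fixed point tends to 1 - e^-1 in either coset of A_m.  So the
   proportion of elements of the coset with a fixed point is uniformly close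
   to (1 - e^-1)^l, with l the number of cycles of b; averaging over the cosets
   in G_m gives the limit.  The inequality holds since every b has at least one
   cycle, and b = 1 has n > 1 cycles. *)

Set Implicit Arguments.
Unset Strict Implicit.
Unset Printing Implicit Defensive.

Import Order.TTheory GRing.Theory Num.Theory.
Import numFieldNormedType.Exports.
Local Open Scope ring_scope.

(** * Derangements of given parity by inclusion-exclusion *)

Definition parity_perms (T : finType) (e : bool) : {set {perm T}} :=
  [set s | odd_perm s == e].

Definition parity_fix_perms (T : finType) (e : bool) : {set {perm T}} :=
  [set s in parity_perms T e | [exists x, s x == x]].

(* Multiplication by a transposition supported in A exchanges the parities. *)
Lemma card_perm_on_parity (T : finType) (A : {set T}) (e : bool) :
  (1 < #|A|)%N ->
  (2 * #|[set s in parity_perms T e | perm_on A s]|)%N = (#|A|)`!.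
Proof.
move=> /card_gt1P[x [y [Ax Ay xNy]]].
pose N e' := [set s in parity_perms T e' | perm_on A s].
have tA : perm_on A (tperm x y).
  apply/fintype.subsetP => z; rewrite inE; apply: contraR => zNA.
  by rewrite tpermD //; apply: contraNneq zNA => <-.
have Nneg e' : #|N e'| = #|N (~~ e')|.
  suff le e1 : (#|N e1| <= #|N (~~ e1)|)%N.
    by apply/eqP; rewrite eqn_leq le; have := le (~~ e'); rewrite negbK.
  rewrite -(card_imset _ (mulgI (tperm x y))); apply/subset_leq_card/fintype.subsetP.
  move=> _ /imsetP[s /[!inE] /andP[/eqP <- sA] ->].
  by rewrite odd_permM odd_tperm xNy eqxx perm_onM.
rewrite -card_perm -[RHS]cardsE -[RHS](cardsID (parity_perms T e)).
have -> : [set s in perm_on A] :&: parity_perms T e = N e.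
  by apply/setP => s; rewrite !inE andbC.
have -> : [set s in perm_on A] :\: parity_perms T e = N (~~ e).
  by apply/setP => s; rewrite !inE; case: odd_perm; case: e {Nneg}.
by rewrite -Nneg mul2n -addnn.
Qed.

Lemma sum_card_sets (T : finType) (V : nmodType) (f : nat -> V) :
  \sum_(A : {set T}) f #|A| = \sum_(k < #|T|.+1) f k *+ 'C(#|T|, k).
Proof.
rewrite (partition_big (fun A : {set T} => inord #|A| : 'I_#|T|.+1) predT) //=.
apply: eq_bigr => k _; rewrite -(card_draws T k) -sumr_const.
apply: eq_big => [A|A /eqP <-]; last by rewrite inordK // ltnS max_card.
by rewrite inE -val_eqE /= inordK // ltnS max_card.
Qed.

(** Inclusion-exclusion: the indicator of a derangement is the product over [x] of 1 - [s x = x]. In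
    its expansion, [A] collects the points where the term 1 is chosen, and the other factors force
    [s] to fix every point off [A]. *)
Lemma card_parity_derangements (R : comPzRingType) (T : finType) (e : bool) :
  #|[set s in parity_perms T e | [forall x, s x != x]]|%:R =
  \sum_(A : {set T}) (-1) ^+ (#|T| - #|A|) *
     #|[set s in parity_perms T e | perm_on A s]|%:R :> R.
Proof.
have prodE (s : {perm T}) : ([forall x, s x != x] : nat)%:R =
    \sum_(A : {set T}) (-1) ^+ (#|T| - #|A|) * (perm_on A s)%:R :> R.
  transitivity (\prod_x (1 + - (s x == x)%:R : R)).
    case: (boolP [forall x, s x != x]) => [/forallP sN|].
      by rewrite big1 // => x _; rewrite (negPf (sN x)) subr0.
    rewrite negb_forall => /existsP[x /negPn/eqP sx].
    by rewrite (bigD1 x) //= sx eqxx subrr mul0r.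
  rewrite bigA_distr; apply: eq_bigr => A _.
  have [sA|] := boolP (perm_on A s); last first.
    move=> /fintype.subsetPn[x sx xNA]; rewrite inE in sx.
    by rewrite mulr0 (bigD1 x) //= (negPf xNA) (negPf sx) oppr0 mul0r.
  have -> : (#|T| - #|A|)%N = #|~: A| by rewrite [RHS]cardsCs finset.setCK.
  rewrite mulr1 -prodr_const [LHS](bigID (mem A)) /=.
  rewrite big1 ?mul1r => [|x ->] //.
  apply: eq_big => [x|x xNA]; first by rewrite inE.
  by rewrite (negPf xNA) (out_perm sA) // eqxx.
have cardE (P : pred {perm T}) : #|[set s in parity_perms T e | P s]|%:R =
    \sum_(s in parity_perms T e) (P s)%:R :> R.
  rewrite -sum1_card natr_sum big_mkcond [RHS]big_mkcond; apply: eq_bigr => s _.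
  by rewrite !inE; case: (_ == e); case: (P s).
rewrite cardE; under [RHS]eq_bigr do rewrite cardE mulr_sumr.
by rewrite exchange_big; apply: eq_bigr => s _; apply: prodE.
Qed.

(** * Proportion of fixed points in a coset of the alternating group *)

Section DerangementAsymptotics.

Local Open Scope classical_set_scope.

Variable R : realType.

(** In the inclusion-exclusion sum a set [A] with at least two points contributes exactly half of
    |A|!, which is its share of the exponential series. Only the m + 1 sets with at most one point
    cause an error, each at most 1 after doubling. *)
Lemma card_parity_derangements_approx m (e : bool) :
  `| #|[set s in parity_perms 'I_m e | [forall x, s x != x]]|%:R / (m`!%:R / 2)
    - series (exp_coeff (-1)) m.+1 | <= m.+1%:R / m`!%:R :> R.
Proof.
have mf0 : 0 < m`!%:R :> R by rewrite ltr0n fact_gt0.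
rewrite card_parity_derangements.
(* The term of index m - k of the series is C(m, k) k! (-1)^(m - k) / m!, that is, the total of the
   [A] of size k. *)
have -> : series (exp_coeff (-1)) m.+1 =
    (\sum_(A : {set 'I_m}) (-1) ^+ (m - #|A|) * (#|A| )`!%:R) / m`!%:R :> R.
  rewrite (sum_card_sets _ (fun k => (-1) ^+ (m - k) * (k`!)%:R)) card_ord.
  rewrite /series /= big_mkord big_distrl (reindex_inj rev_ord_inj) /=.
  apply: eq_bigr => k _; rewrite subSS /exp_coeff /=.
  have km : (k <= m)%N by rewrite -ltnS.
  rewrite -mulr_natr -(bin_fact km) !natrM.
  have C0 : 'C(m, k)%:R != 0 :> R by rewrite pnatr_eq0 -lt0n bin_gt0.
  have k0 : k`!%:R != 0 :> R by rewrite pnatr_eq0 -lt0n fact_gt0.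
  have mk0 : (m - k)`!%:R != 0 :> R by rewrite pnatr_eq0 -lt0n fact_gt0.
  by field; rewrite C0 k0 mk0.
rewrite card_ord invf_div mulrA -mulrBl normrM [X in _ * X <= _]gtr0_norm ?invr_gt0 //.
rewrite ler_pM2r ?invr_gt0 // mulr_suml -sumrB.
apply: le_trans (ler_norm_sum _ _ _) _.
apply: (@le_trans _ _ (\sum_(A : {set 'I_m}) (#|A| <= 1)%N%:R)).
  apply: ler_sum => A _; rewrite -mulrA -mulrBr normrM normrX normrN1 expr1n mul1r.
  have [A1|A1] := leqP #|A| 1; last first.
    by rewrite -(card_perm_on_parity e A1) natrM mulrC subrr normr0.
  (* Only the identity is supported on such an [A], and it lies in one of the two classes: the error
     is |0 - 1| or |2 - 1|. *)
  have fA : (#|A| )`! = 1%N by case: #|A| A1 => [|[]].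
  have : (#|[set s in parity_perms 'I_m e | perm_on A s]| <= 1)%N.
    rewrite -[X in (_ <= X)%N]fA -card_perm; apply/subset_leq_card.
    by apply/fintype.subsetP => s; rewrite inE => /andP[].
  rewrite fA; case: #|[set s in _ | _]| => [|[|//]] _.
    by rewrite mul0r sub0r normrN1.
  by rewrite mul1r (_ : 2 - 1 = 1 :> R) ?normr1 //; lra.
rewrite (sum_card_sets _ (fun k => (k <= 1)%N%:R)) card_ord.
rewrite (_ : \sum_(k < m.+1) _ = \sum_(k < m.+1 | (k <= 1)%N) 'C(m, k)%:R); last first.
  by rewrite [RHS]big_mkcond; apply: eq_bigr => k _; case: ifP; rewrite ?mul0rn.
case: m {mf0} => [|m]; first by rewrite big_mkcond big_ord1 bin0.
rewrite big_mkcond !big_ord_recl big1 //= bin0 bin1 addr0.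
by rewrite -natrD add1n.
Qed.


Definition fix_ratio m (e : bool) : R :=
  #|parity_fix_perms 'I_m e|%:R / #|parity_perms 'I_m e|%:R.

Lemma card_parity_perms m (e : bool) : (1 < m)%N ->
  (2 * #|parity_perms 'I_m e|)%N = m`!.
Proof.
move=> m1; rewrite -[in RHS](card_ord m) -cardsT.
rewrite -(card_perm_on_parity e) ?cardsT ?card_ord //.
congr (2 * _)%N; apply: eq_card => s; rewrite !inE.
by case: (_ == e) => //=; apply/esym/fintype.subsetP => x; rewrite inE.
Qed.

Lemma cvg_fix_ratio (e : bool) : fix_ratio ^~ e @ \oo --> 1 - expR (-1).
Proof.
pose d m : R :=
  #|[set s in parity_perms 'I_m e | [forall x, s x != x]]|%:R / (m`!%:R / 2).
(* The identity needs 1 < m, so that the class is nonempty with m!/2 elements. *)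
have dE : {near \oo, (fun m => 1 - d m) =1 fix_ratio ^~ e}.
  near=> m.
  have m1 : (1 < m)%N by near: m; exists 2%N.
  have := card_parity_perms e m1 => cP.
  have P0 : #|parity_perms 'I_m e|%:R != 0 :> R.
    by rewrite pnatr_eq0; apply/eqP => P0; have := fact_gt0 m; rewrite -cP P0.
  rewrite /d -cP natrM mulrAC divff ?pnatr_eq0 // mul1r /fix_ratio.
  rewrite -[X in X - _](divff P0) -mulrBl; congr (_ / _).
  rewrite -[X in X%:R - _](cardsID [set s : 'S_m | [exists x, s x == x]]).
  rewrite natrD -addrA [X in _ + X](_ : _ = 0) ?addr0; last first.
    apply/eqP; rewrite subr_eq0; apply/eqP; congr _%:R.
    by apply: eq_card => s; rewrite !inE negb_exists andbC.
  by congr _%:R; apply: eq_card => s; rewrite !inE.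
apply: cvg_trans (near_eq_cvg dE) _.
apply: cvgB; first exact: cvg_cst.
rewrite -(subr0 (expR (-1))).
have -> : d = (fun m => series (exp_coeff (-1)) m.+1 -
                 (series (exp_coeff (-1)) m.+1 - d m)).
  by apply/boolp.funext => m; rewrite subKr.
apply: cvgB.
  have -> : expR (-1) = limn (series (exp_coeff (-1 : R))) by [].
  by rewrite (cvg_shiftS (series _)); exact: is_cvg_series_exp_coeff.
apply/norm_cvg0P.
apply: (@squeeze_cvgr _ _ _ _ (fun=> 0) (fun m => m.+1%:R / m`!%:R)).
- near=> m; rewrite normr_ge0 /= distrC; exact: card_parity_derangements_approx.
- exact: cvg_cst.
(* After the shift, (m + 2) / (m + 1)! <= 2 / m!, twice a term of the series of e. *)
rewrite -(cvg_shiftS (fun m => m.+1%:R / m`!%:R : R)).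
apply: (@squeeze_cvgr _ _ _ _ (fun=> 0) (fun m => 2 * exp_coeff 1 m)).
- near=> m; rewrite divr_ge0 //= /exp_coeff /= expr1n mul1r factS natrM invfM mulrA.
  rewrite ler_pM2r ?invr_gt0 ?ltr0n ?fact_gt0 // ler_pdivrMr // -natrM ler_nat.
  by lia.
- exact: cvg_cst.
by rewrite -(mulr0 2); apply: cvgM; [exact: cvg_cst|exact: cvg_exp_coeff].
Unshelve. all: by end_near.
Qed.

End DerangementAsymptotics.

(** * Fixed functions and products along cycles *)

Section CycleProducts.

Local Open Scope group_scope.

Variables (T U : finType) (b : {perm T}).
Implicit Type a : {ffun T -> {perm U}}.

(** The choice made by [pick] depends only on the orbit as a set, so it is constant on each cycle;
    the default [y] is never reached, since an orbit is nonempty. *)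
Definition cycle_rep (y : T) : T := odflt y [pick z in porbit b y].

Definition cycle_reps : {set T} := [set y | cycle_rep y == y].

Lemma mem_cycle_rep y : cycle_rep y \in porbit b y.
Proof. by rewrite /cycle_rep; case: pickP => //= _; apply: porbit_id. Qed.

Lemma eq_cycle_rep y z : porbit b y = porbit b z -> cycle_rep y = cycle_rep z.
Proof.
move=> yz; rewrite /cycle_rep -yz; case: pickP => //= /(_ y).
by rewrite porbit_id.
Qed.

Lemma porbit_cycle_rep y : porbit b (cycle_rep y) = porbit b y.
Proof. by apply/eqP; rewrite eq_porbit_mem mem_cycle_rep. Qed.

Lemma cycle_rep_id y : cycle_rep (cycle_rep y) = cycle_rep y.
Proof. exact/eq_cycle_rep/porbit_cycle_rep. Qed.

Lemma card_cycle_reps : #|cycle_reps| = #|porbits b|.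
Proof.
rewrite -(@card_in_imset _ _ (porbit b) cycle_reps) => [|y z].
  apply: eq_card => O; apply/imsetP/imsetP => -[y _ ->]; first by exists y.
  by exists (cycle_rep y); rewrite ?porbit_cycle_rep // inE cycle_rep_id.
by rewrite !inE => /eqP {2}<- /eqP {2}<- /eq_cycle_rep.
Qed.

(** The map that carries the value of a fixed function at [y] to its value k steps further along the
    cycle; factors act in the order of the visit. *)
Definition path_prod a k y : {perm U} := \prod_(i < k) a ((b ^+ i) y).

Definition cycle_prod a y := path_prod a #|porbit b y| y.

Lemma fixed_path_prod a (w : {ffun T -> U}) :
  (forall y, w (b y) = a y (w y)) ->
  forall k y, w ((b ^+ k) y) = path_prod a k y (w y).
Proof.
move=> wP; elim=> [|k IHk] y; first by rewrite /path_prod big_ord0 !perm1.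
by rewrite /path_prod big_ord_recr expgSr !permM wP IHk.
Qed.

(** Going once around a cycle returns to the starting value, which the cycle product must therefore
    fix. Conversely, a fixed point chosen at each representative propagates along its cycle, and the
    values match when the cycle closes. *)
Lemma fixed_functionP a :
  (exists w : {ffun T -> U}, forall y, w (b y) = a y (w y)) <->
  (forall r, r \in cycle_reps -> exists x, cycle_prod a r x = x).
Proof.
split=> [[w wP] r _|].
  by exists (w r); rewrite -fixed_path_prod // permX iter_porbit.
move=> fixP.
have /fin_all_exists[f fP] y : exists x, cycle_prod a (cycle_rep y) x = x.
  by apply: fixP; rewrite inE cycle_rep_id.
(* The cycle of [y] listed from its representative r, so that the index i of [y] satisfies y = b^i
   r. *)
pose tr y := traject b (cycle_rep y) #|porbit b (cycle_rep y)|.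
have nth_tr y i : (i < #|porbit b (cycle_rep y)|)%N ->
    nth (cycle_rep y) (tr y) i = (b ^+ i) (cycle_rep y).
  by move=> iO; rewrite /tr nth_traject // permX.
have y_tr y : y \in tr y by rewrite -porbit_traject porbit_sym mem_cycle_rep.
have tr_uniq y : uniq (tr y) by apply: uniq_traject_porbit.
have idx_tr y i : (i < #|porbit b (cycle_rep y)|)%N ->
    index ((b ^+ i) (cycle_rep y)) (tr y) = i.
  by move=> iO; rewrite -nth_tr // index_uniq // size_traject.
exists [ffun y => path_prod a (index y (tr y)) (cycle_rep y) (f (cycle_rep y))].
move=> y; rewrite !ffunE.
have rby : cycle_rep (b y) = cycle_rep y.
  by apply: eq_cycle_rep; have := porbit_perm b 1 y; rewrite expg1.
have -> : tr (b y) = tr y by rewrite /tr rby.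
rewrite rby; set r := cycle_rep y; set i := index y (tr y).
have iO : (i < #|porbit b r|)%N by rewrite -[X in (_ < X)%N](size_traject b r) index_mem.
have yE : y = (b ^+ i) r by rewrite -nth_tr // nth_index.
have -> : a y (path_prod a i r (f r)) = path_prod a i.+1 r (f r).
  by rewrite /path_prod big_ord_recr permM /= {1}yE.
have -> : b y = (b ^+ i.+1) r by rewrite expgSr permM -yE.
(* Either the next point is still in the list, or the cycle closes: the index drops to 0 and the
   equation says that the cycle product fixes the chosen value. *)
have [iO'|] := ltnP i.+1 #|porbit b r|; first by rewrite idx_tr.
move=> Oi; have {Oi}<- : #|porbit b r| = i.+1 by apply/eqP; rewrite eqn_leq Oi iO.
rewrite permX iter_porbit -/r -[in index r](perm1 r) -[1]/(b ^+ 0) idx_tr.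
  rewrite [path_prod a 0 r]big_ord0 perm1; apply: esym.
  by have := fP r; rewrite /r cycle_rep_id.
by rewrite lt0n card_porbit_neq0.
Qed.

(* An injection between parity classes of the same size, hence a bijection:
   this is what makes the cycle products independent and uniform. *)
Definition concentrate a : {ffun T -> {perm U}} :=
  [ffun y => if y \in cycle_reps then cycle_prod a y else a y].

(** Off the representatives [a] is unchanged. At a representative the cycle product is the value of
    [a] there times values at other points, so that value is recovered by cancellation. *)
Lemma concentrate_inj : injective concentrate.
Proof.
move=> a a' aa'.
have off y : y \notin cycle_reps -> a y = a' y.
  by move=> yN; have /ffunP/(_ y) := aa'; rewrite !ffunE (negPf yN).
apply/ffunP => y; have [yR|/off//] := boolP (y \in cycle_reps).
have /ffunP/(_ y) := aa'; rewrite !ffunE yR /cycle_prod /path_prod.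
have := card_porbit_neq0 b y; case cO : #|porbit b y| => [|k] // _.
rewrite !big_ord_recl /= !perm1.
set p := (X in _ * X = _ -> _); set p' := (X in _ = _ * X -> _).
suff -> : p = p' by exact: mulIg.
(* The remaining factors sit at points b^j y with 0 < j < the length of the cycle. These differ from
   [y], hence are not representatives. *)
apply: eq_bigr => i _; apply: off.
rewrite inE (@eq_cycle_rep _ y) ?porbit_perm //.
move: yR; rewrite inE => /eqP ->.
have := uniq_traject_porbit b y; rewrite cO => /(nth_uniq y).
have ik : (bump 0 i < k.+1)%N by exact: ltn_ord (lift ord0 i).
move=> /(_ 0%N (bump 0 i)); rewrite size_traject !nth_traject //.
by rewrite /= permX => ->.
Qed.

Lemma odd_concentrate a a' : (forall y, odd_perm (a y) = odd_perm (a' y)) ->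
  forall y, odd_perm (concentrate a y) = odd_perm (concentrate a' y).
Proof.
move=> aa' y; rewrite !ffunE; case: ifP => // _.
rewrite /cycle_prod /path_prod !(big_morph _ (@odd_permM _) (@odd_perm1 _)).
by apply: eq_bigr => i _.
Qed.

End CycleProducts.

(** * Counting in parity classes of functions *)

Lemma card_ffun_family (T V : finType) (F : T -> {set V}) :
  #|[set a : {ffun T -> V} | [forall y, a y \in F y]]| = (\prod_y #|F y|)%N.
Proof.
transitivity #|(family (fun y => mem (F y)) : simpl_pred {ffun T -> V})|.
  by apply: eq_card => a; rewrite !inE.
by rewrite card_family foldrE big_map big_enum.
Qed.

(** The coset of [a0] modulo the functions with values in the alternating group. *)
Definition parity_class (T U : finType) (a0 : {ffun T -> {perm U}}) :
    {set {ffun T -> {perm U}}} :=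
  [set a : {ffun T -> {perm U}} |
    [forall y, a y \in parity_perms U (odd_perm (a0 y))]].

(** The parity of a cycle product depends only on the parities of its factors, which gives one
    inclusion. Injectivity gives equality, as for 1 < m all parity classes have the same size. *)
Lemma concentrate_parity_class (T : finType) m (b : {perm T})
    (a0 : {ffun T -> 'S_m}) : (1 < m)%N ->
  concentrate b @: parity_class a0 = parity_class (concentrate b a0).
Proof.
move=> m1; apply/eqP; rewrite eqEcard; apply/andP; split.
  apply/fintype.subsetP => _ /imsetP[a /[!inE] /forallP aP ->].
  apply/forallP => y; rewrite inE; apply/eqP; apply: odd_concentrate => z.
  by have := aP z; rewrite inE => /eqP.
rewrite (card_imset _ (@concentrate_inj _ _ b)) !card_ffun_family leq_prod //.
move=> y _; rewrite -(leq_pmul2l (isT : 0 < 2)%N).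
by rewrite !(card_parity_perms _ m1).
Qed.

(** Under [concentrate] the existence of a fixed function becomes a separate condition at each
    point, a fixed point at representatives and none elsewhere, so the count factors. *)
Lemma card_parity_class_fix (T : finType) m (b : {perm T})
    (a0 : {ffun T -> 'S_m}) : (1 < m)%N ->
  #|[set a in parity_class a0 |
      [exists w : {ffun T -> 'I_m}, [forall y, w (b y) == a y (w y)]]]| =
  (\prod_y #|if y \in cycle_reps b
             then parity_fix_perms 'I_m (odd_perm (concentrate b a0 y))
             else parity_perms 'I_m (odd_perm (concentrate b a0 y))|)%N.
Proof.
move=> m1; rewrite -card_ffun_family -(card_imset _ (@concentrate_inj _ _ b)).
apply: eq_card => c; rewrite !inE; apply/imsetP/forallP.
  move=> [a /[!inE] /andP[aP /existsP[w /forallP wP]] -> y].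
  have : concentrate b a \in parity_class (concentrate b a0).
    by rewrite -concentrate_parity_class //; apply: imset_f; rewrite inE.
  rewrite inE => /forallP/(_ y); case: ifP => // yR cP.
  rewrite inE cP; apply/existsP.
  have [] := (fixed_functionP b a).1 _ y yR.
    by exists w => z; apply/eqP/wP.
  by move=> x xP; exists x; rewrite ffunE yR xP.
move=> cP; have : c \in parity_class (concentrate b a0).
  rewrite inE; apply/forallP => y; have := cP y; case: ifP => // _.
  by rewrite inE => /andP[].
rewrite -concentrate_parity_class // => /imsetP[a aP ca]; exists a => //.
rewrite inE aP; have [|w wP] := (fixed_functionP b a).2.
  move=> r rR; have := cP r; rewrite rR inE => /andP[_ /existsP[x /eqP]].
  by rewrite ca ffunE rR => xP; exists x.
by apply/existsP; exists w; apply/forallP => y; apply/eqP.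
Qed.

(** * Estimating products and summing over fibres *)

Lemma ler_norm_prod_sub_exp (R : realDomainType) (I : finType) (P : pred I)
    (F : I -> R) (q eta : R) :
  0 <= q <= 1 -> (forall i, 0 <= F i <= 1) -> (forall i, `|F i - q| <= eta) ->
  `|\prod_(i | P i) F i - q ^+ #|P| | <= #|P|%:R * eta.
Proof.
move=> q01 F01 Fq; rewrite -prodr_const mulr_natl -sumr_const.
(* For numbers in [0, 1] the errors of two products add up at most; the invariant keeps the bounds
   needed to go on by induction. *)
pose K (x y z : R) := [/\ 0 <= x <= 1, 0 <= y <= 1 & `|x - y| <= z].
suff [] : K (\prod_(i | P i) F i) (\prod_(i | P i) q) (\sum_(i | P i) eta) by [].
elim/big_ind3: _ => [|x3 x2 x1 y3 y2 y1 [x1P x2P xP] [y1P y2P yP]|//].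
  by split; rewrite ?lexx ?ler01 // subrr normr0.
split; [nra|nra|].
have -> : x1 * y1 - x2 * y2 = (x1 - x2) * y1 + x2 * (y1 - y2) by ring.
apply: le_trans (ler_normD _ _) _; rewrite !normrM.
rewrite (@ger0_norm _ y1) 1?(@ger0_norm _ x2); [|lra|lra].
by apply: lerD; [apply: le_trans xP; apply: ler_piMr | apply: le_trans yP;
  apply: ler_piMl]; rewrite ?normr_ge0 //; lra.
Qed.

(** The fibres of [f] on [G] are cosets of its kernel in [G], all of the same size. *)
Lemma sum_morphim (aT rT : finGroupType) (D G : {group aT})
    (f : {morphism D >-> rT}) (V : nmodType) (F : rT -> V) : G \subset D ->
  \sum_(g in G) F (f g) = (\sum_(b in (f @* G)%g) F b) *+ #|('ker_G f)%g|.
Proof.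
move=> sGD; rewrite (partition_big f (mem (f @* G)%g)) => [|g gG]; last first.
  by apply: mem_morphim => //; apply: (fintype.subsetP sGD).
rewrite -sumrMnl; apply: eq_bigr => _ /morphimP[g0 Dg0 Gg0 ->].
rewrite (eq_bigr (fun=> F (f g0))) => [|g /andP[_ /eqP-> //]].
rewrite sumr_const -(card_lcoset ('ker_G f)%g g0); congr (_ *+ _).
apply: eq_card => g; rewrite mem_lcoset !inE groupMl ?groupV //.
rewrite unfold_in; have [Gg|//] := boolP (g \in G).
have Dg := fintype.subsetP sGD g Gg.
by rewrite groupM ?groupV // morphM ?morphV ?groupV // -eq_mulVg1 eq_sym.
Qed.

(** * Fixed points in cosets of the alternating base group *)

Section PowerAction.

Variables m n : nat.
Implicit Types g k : wreath m n.
Local Notation pact := (power_action m n).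

(** The fixed-point equation of the power action read at the image of [y] under the top permutation,
    which removes the inverses. *)
Definition fixes_point g : bool :=
  [exists w : {ffun 'I_n -> 'I_m}, [forall y, w (wr_top g y) == wr_base g y (w y)]].

Lemma Fix_power_eq0 g : ('Fix_pact[g]%g == finset.set0) = ~~ fixes_point g.
Proof.
apply/idP/idP => [/eqP F0|].
  apply/existsP => -[w /forallP wP]; suff : w \in 'Fix_pact[g]%g.
    by rewrite F0 inE.
  apply/afix1P/ffunP => y; rewrite ffunE /=.
  by rewrite -(eqP (wP _)) permKV.
apply: contraR => /finset.set0Pn[w /afix1P /ffunP wP]; apply/existsP; exists w.
by apply/forallP => y; rewrite -{1}wP ffunE /= permK.
Qed.

Lemma mem_alt_base_coset g k :
  (k \in g *: alt_base m n)%g =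
  (wr_top k == wr_top g) && (wr_base k \in parity_class (wr_base g)).
Proof.
rewrite mem_lcoset !inE /= andbC -eq_mulVg1 [wr_top g == _]eq_sym.
case: eqP => //= _; apply/forallP/forallP => gk y.
  have := gk (wr_top g y); rewrite !ffunE /= invgK !permK Alt_even.
  by rewrite odd_permM odd_permV inE negb_add eq_sym.
have := gk ((wr_top g)^-1 y)%g; rewrite !ffunE /= invgK Alt_even.
by rewrite odd_permM odd_permV inE negb_add eq_sym.
Qed.

(** Both cardinals are products over all points; the factors off the representatives cancel, leaving
    one ratio per cycle. *)
Lemma coset_fix_ratio (R : realType) g : (1 < m)%N ->
  #|[set k in (g *: alt_base m n)%g | fixes_point k]|%:R / #|alt_base m n|%:R =
  \prod_(y in cycle_reps (wr_top g))
     fix_ratio R m (odd_perm (concentrate (wr_top g) (wr_base g) y)).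
Proof.
move=> m1; have wrI : injective (@Wreath m n ^~ (wr_top g)) by move=> a a' [].
have cosetE (P : pred (wreath m n)) :
    #|[set k in (g *: alt_base m n)%g | P k]| =
    #|[set a in parity_class (wr_base g) | P (Wreath a (wr_top g))]|.
  rewrite -(card_imset _ wrI); apply: eq_card => -[a b].
  rewrite inE mem_alt_base_coset /=; apply/idP/imsetP.
    by move=> /andP[/andP[/eqP-> aP] Pa]; exists a => //; apply/finset.setIdP.
  by move=> [a' /finset.setIdP[aP Pa] [-> ->]]; rewrite eqxx aP.
have -> : #|alt_base m n| =
    (\prod_y #|parity_perms 'I_m
                (odd_perm (concentrate (wr_top g) (wr_base g) y))|)%N.
  rewrite -(card_lcoset _ g) -card_ffun_family -/(parity_class _).
  rewrite -concentrate_parity_class // (card_imset _ (@concentrate_inj _ _ _)).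
  have := cosetE predT; set A := [set _ in _ | _]; set A' := [set _ in _ | _].
  have -> : A = (g *: alt_base m n)%g by apply/setP => k; rewrite inE andbT.
  by have -> : A' = parity_class (wr_base g) by apply/setP => k; rewrite inE andbT.
rewrite cosetE card_parity_class_fix // !natr_prod -prodf_div [RHS]big_mkcond.
apply: eq_bigr => y _; case: ifP => // _; rewrite divff // pnatr_eq0.
by rewrite -(eqn_pmul2l (isT : 0 < 2)%N) (card_parity_perms _ m1) -lt0n fact_gt0.
Qed.

(** Double counting of pairs: each [k] in [G] lies in the coset of [g] for exactly the [g] in the
    coset of [k]. This permits averaging over all of [G] without choosing coset representatives. *)
Lemma sum_card_coset_fix (G : {group wreath m n}) :
  alt_base m n \subset G ->
  (\sum_(g in G) #|[set k in (g *: alt_base m n)%g | fixes_point k]| =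
   #|alt_base m n| * #|[set k in G | fixes_point k]|)%N.
Proof.
move=> sNG; under eq_bigr do rewrite -sum1_card.
rewrite (exchange_big_dep [pred k in G | fixes_point k]) /=; last first.
  move=> g k gG; rewrite !inE => /andP[kg ->]; rewrite andbT.
  by case/lcosetP: kg => x /(fintype.subsetP sNG) xG ->; rewrite groupM.
rewrite mulnC -sum_nat_const; apply: eq_big => [k|k /andP[kG fk]].
  by rewrite inE.
rewrite sum1_card -(card_lcoset _ k); apply: eq_card => g.
rewrite unfold_in inE fk andbT -lcoset_sym andbC.
case gk: (g \in _) => //=; case/lcosetP: gk => x /(fintype.subsetP sNG) xG ->.
by rewrite groupM.
Qed.

End PowerAction.

(** * Averages over the group and numbers of cycles *)

Lemma card_porbits_gt0 n (b : 'S_n) : (0 < n)%N -> (0 < #|porbits b|)%N.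
Proof.
move=> n0; rewrite card_gt0; apply/finset.set0Pn.
by exists (porbit b (Ordinal n0)); apply: imset_f.
Qed.

Lemma sum_porbits_cycle_count (R : pzSemiRingType) n (B : {group 'S_n}) (x : R) :
  (0 < n)%N ->
  \sum_(b in B) x ^+ #|porbits b| =
  \sum_(1 <= l < n.+1) (cycle_count B l)%:R * x ^+ l.
Proof.
move=> n0; transitivity (\sum_(b in B) \sum_(1 <= l < n.+1 | l == #|porbits b|) x ^+ l).
  apply: eq_bigr => b _; rewrite big_nat1_eq ltnS.
  rewrite card_porbits_gt0 //=.
  by rewrite -card_cycle_reps -[X in (_ <= X)%N](card_ord n) max_card.
rewrite (exchange_big_dep predT) //=; apply: eq_bigr => l _.
rewrite sumr_const mulr_natl; congr (_ *+ _).
by apply: eq_card => b; rewrite [RHS]inE eq_sym.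
Qed.

(** The proportion with a fixed point is the mean over [g] of the ratio in the coset of [g], a
    product with one factor within [eta] of [q] for each of the at most n cycles. *)
Lemma derangement_proportion_approx (R : realType) (m n : nat)
    (G : {group wreath m n}) (q eta : R) :
  (1 < m)%N -> alt_base m n \subset G -> 0 <= q <= 1 ->
  (forall e, `|fix_ratio R m e - q| <= eta) ->
  `|derangement_proportion R (power_action m n) G -
    (1 - #|(@wr_top m n @* G)%g|%:R^-1 *
         \sum_(b in (@wr_top m n @* G)%g) q ^+ #|porbits b|)| <= n%:R * eta.
Proof.
move=> m1 sNG q01 fq; set B := (_ @* G)%g.
have G0 : 0 < #|G|%:R :> R by rewrite ltr0n cardG_gt0.
have N0 : 0 < #|alt_base m n|%:R :> R by rewrite ltr0n cardG_gt0.
have eta0 : 0 <= eta by apply: le_trans (fq true).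
(* The mean over [B] is pulled back to a mean over [G], so that the two means are compared term by
   term. *)
have sumB : #|B|%:R^-1 * \sum_(b in B) q ^+ #|porbits b| =
    #|G|%:R^-1 * \sum_(g in G) q ^+ #|porbits (wr_top g)|.
  have sGT : G \subset [set: wreath m n]%SET by apply/fintype.subsetP => g; rewrite inE.
  have cardG : #|G| = (#|B| * #|('ker_G (wr_top_morphism m n))%g|)%N.
    have := sum_morphim (wr_top_morphism m n) (fun=> 1%N) sGT.
    by rewrite !sum1_card -mulr_natr natn.
  rewrite (sum_morphim (wr_top_morphism m n) (fun b => q ^+ #|porbits b|) sGT).
  rewrite cardG -mulr_natr natrM; set K := #|('ker_G _)%g|%:R.
  have K0 : K != 0 :> R by rewrite pnatr_eq0 -lt0n cardG_gt0.
  have B0 : #|B|%:R != 0 :> R by rewrite pnatr_eq0 -lt0n cardG_gt0.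
  by field; rewrite K0 B0.
rewrite sumB.
have -> : derangement_proportion R (power_action m n) G =
    1 - #|[set g in G | fixes_point g]|%:R / #|G|%:R.
  rewrite /derangement_proportion -[X in X - _](divff (lt0r_neq0 G0)) -mulrBl.
  congr (_ / _); rewrite -[in X in X - _](cardsID [set g | fixes_point g] G) natrD.
  rewrite [X in _ = X + _ - _](_ : _ = #|[set g in G | fixes_point g]|%:R); last first.
    by congr _%:R; apply: eq_card => g; rewrite !inE.
  rewrite addrC addKr; congr _%:R; apply: eq_card => g.
  by rewrite inE Fix_power_eq0 !inE andbC.
rewrite opprD addrACA subrr add0r opprK addrC.
have -> : #|[set g in G | fixes_point g]|%:R = \sum_(g in G)
    #|[set k in (g *: alt_base m n)%g | fixes_point k]|%:R / #|alt_base m n|%:R :> R.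
  by rewrite -mulr_suml -natr_sum sum_card_coset_fix // natrM mulrC mulKf ?lt0r_neq0.
rewrite [X in _ - X]mulrC -mulrBr normrM gtr0_norm ?invr_gt0 //.
rewrite mulrC ler_pdivrMr // -sumrB.
apply: le_trans (ler_norm_sum _ _ _) _.
rewrite mulr_natr -[leRHS]sumr_const; apply: ler_sum => g gG.
rewrite coset_fix_ratio // -card_cycle_reps distrC.
apply: le_trans (ler_norm_prod_sub_exp _ _ _ _) _ => //.
- move=> y; rewrite divr_ge0 //= ler_pdivrMr ?mul1r ?ler_nat.
    by apply/subset_leq_card/fintype.subsetP => s; rewrite inE => /andP[].
  rewrite ltr0n -(ltn_pmul2l (isT : 0 < 2)%N) muln0 card_parity_perms //.
  exact: fact_gt0.
- by rewrite ler_wpM2r // ler_nat -[X in (_ <= X)%N](card_ord n) max_card.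
Qed.

Lemma porbits_one (T : finType) : #|porbits (1 : {perm T})%g| = #|T|.
Proof.
rewrite /porbits card_imset // => x y xy.
have : x \in porbit 1%g y by rewrite -xy porbit_id.
by case/porbitP => i ->; rewrite expg1n perm1.
Qed.

(** Each term is at most [q], since there is at least one cycle; the term of the identity is q^n <
    q. *)
Lemma mean_porbits_lt (R : realFieldType) n (B : {group 'S_n}) (q : R) :
  (1 < n)%N -> 0 < q < 1 ->
  #|B|%:R^-1 * \sum_(b in B) q ^+ #|porbits b| < q.
Proof.
move=> n1 /andP[q0 q1]; have B0 : 0 < #|B|%:R :> R by rewrite ltr0n cardG_gt0.
rewrite mulrC ltr_pdivrMr // mulr_natr -sumr_const.
rewrite (bigD1 (1 : 'S_n)%g) // [ltRHS](bigD1 (1 : 'S_n)%g) //=.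
apply: ltr_leD.
  by rewrite porbits_one card_ord -[ltRHS]expr1 ltr_iXn2l.
apply: ler_sum => b _; have := card_porbits_gt0 b (ltnW n1).
case: #|porbits b| => // k _; rewrite exprS ler_piMr ?(ltW q0) //.
by apply: exprn_ile1; exact: ltW.
Qed.

(** * The limit and its lower bound *)

Local Open Scope classical_set_scope.

Theorem corollary6p10 (R : realType) (n : nat) (B : {group 'S_n})
    (G : forall m : nat, {group wreath m n}) :
  (2 <= n)%N ->
  (forall m : nat, (1 <= m)%N -> normal (alt_base m n) (G m)) ->
  (forall m : nat, (1 <= m)%N -> (@wr_top m n @* G m)%g = B :> {set 'S_n}) ->
  let L : R := 1 - #|B|%:R^-1 *
      \sum_(1 <= l < n.+1) (cycle_count B l)%:R * (1 - expR (-1)) ^+ l in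
  (derangement_proportion R (power_action m n) (G m) @[m --> \oo] --> L) /\
  expR (-1) < L.
Proof.
move=> n2 nNG GB L.
have q01 : 0 < (1 - expR (-1) : R) < 1.
  by rewrite subr_gt0 gtrBl expR_gt0 expR_lt1 ltrN10.
rewrite /L -sum_porbits_cycle_count 1?ltnW //; split; last first.
  by have := mean_porbits_lt B n2 q01; lra.
move: q01 => /andP[/ltW q0 /ltW q1]; set q := 1 - expR (-1) in q0 q1 *.
(* The sum of the two errors bounds each of them, so one null sequence serves both parities. *)
pose eta m := `|fix_ratio R m true - q| + `|fix_ratio R m false - q|.
apply/subr_cvg0/norm_cvg0P.
apply: (@squeeze_cvgr _ _ _ _ (fun=> 0) (fun m => n%:R * eta m)).
- near=> m; rewrite normr_ge0 /=.
  have m1 : (1 < m)%N by near: m; exists 2%N.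
  rewrite -(GB m (ltnW m1)); apply: derangement_proportion_approx => //.
  + by case/andP: (nNG m (ltnW m1)).
  + by rewrite q0.
  + by case; rewrite /eta ?lerDl ?lerDr.
- exact: cvg_cst.
rewrite -(mulr0 n%:R); apply: cvgM; first exact: cvg_cst.
rewrite -(addr0 0); apply: cvgD.
  exact/norm_cvg0P/subr_cvg0/cvg_fix_ratio.
exact/norm_cvg0P/subr_cvg0/cvg_fix_ratio.
Unshelve. all: by end_near.
Qed.
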